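(* Let $k\ge 3$ be an integer. Let $\mathcal{C}^{\mathrm{tyt}}_k$, $\mathcal{C}^{\mathrm{lse}}_k$, $\mathcal{P}^{\mathrm{tyt}}_k$, $\mathcal{P}^{\mathrm{lse}}_k$ denote the classes of $k$-uniform tight cycles, $k$-uniform loose cycles, $k$-uniform tight paths, and $k$-uniform loose paths, respectively. Then $$\chi_{\mathrm{co}}(\mathcal{C}^{\mathrm{tyt}}_k)=\chi_{\mathrm{co}}(\mathcal{C}^{\mathrm{lse}}_k)=\chi_{\mathrm{co}}(\mathcal{P}^{\mathrm{tyt}}_k)=\chi_{\mathrm{co}}(\mathcal{P}^{\mathrm{lse}}_k)=2.$$
   Context: A hypergraph is a pair $(V,E)$ where $V$ is a set (of vertices) and $E$ is a family of subsets of $V$ (edges); it is $k$-uniform if every edge has exactly $k$ vertices. A set $I\subseteq V$ is independent in $H=(V,E)$ if no edge of $H$ is contained in $I$. Given hypergraphs $H_1,\ldots,H_m$ (not necessarily distinct) with the same vertex set $V$, a cooperative coloring of them is a partition $\{I_1,\ldots,I_m\}$ of $V$ (indexed; parts may be empty) such that $I_i$ is independent in $H_i$ for each $i\in\{1,\ldots,m\}$. For a class $\mathcal{H}$ of hypergraphs, the cooperative chromatic number $\chi_{\mathrm{co}}(\mathcal{H})$ is the least number $m$ such that any $m$ hypergraphs (not necessarily distinct) from $\mathcal{H}$ on a common vertex set have a cooperative coloring. A $k$-uniform tight cycle is a $k$-uniform hypergraph whose vertices can be arranged in a sequence $v_0,v_1,\ldots,v_{n-1}$ of distinct vertices ($n\ge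 k$) such that its edges are exactly the sets $\{v_i,v_{i+1},\ldots,v_{i+k-1}\}$ for $i\in\mathbb{Z}_n$, with indices modulo $n$. A $k$-uniform loose cycle is a $k$-uniform hypergraph whose edges form a sequence $e_0,e_1,\ldots,e_{m-1}$ such that for each $i\in\mathbb{Z}_m$, $e_i\cap e_{i+1}=\{v_i\}$ (where $e_m=e_0$), all the vertices $v_i$ are distinct, and non-consecutive edges do not share any vertices; its vertex set is the union of its edges. A $k$-uniform tight path is a $k$-uniform hypergraph whose vertices can be arranged in a sequence $v_0,\ldots,v_{n-1}$ of distinct vertices ($n\ge k$) such that its edges are exactly the sets $\{v_i,v_{i+1},\ldots,v_{i+k-1}\}$ for $0\le i\le n-k$. A $k$-uniform loose path is a $k$-uniform hypergraph whose edges form a sequence $e_0,\ldots,e_{m-1}$ ($m\ge1$) such that $e_i\cap e_{i+1}=\{v_i\}$ for $0\le i\le m-2$, all the vertices $v_i$ are distinct, and non-consecutive edges do not share any vertices; its vertex set is the union of its edges. *)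

(* Defs.v *)
From mathcomp Require Import all_boot.

Set Implicit Arguments.
Unset Strict Implicit.
Unset Printing Implicit Defensive.

(* A hypergraph whose vertex set is all of V, given by its set of edges.
   The members of the four classes below are finite, so V is a finType. *)
Definition hypergraph (V : finType) := {set {set V}}.

Definition uniform (V : finType) (k : nat) (E : hypergraph V) : Prop :=
  forall e : {set V}, e \in E -> #|e| = k.

Definition independent (V : finType) (E : hypergraph V) (I : {set V}) : Prop :=
  forall e : {set V}, e \in E -> ~~ (e \subset I).

(* Parts are indexed and may be empty, hence not finset's [partition]. *)
Definition cooperative_coloring (V : finType) (m : nat)
    (H : 'I_m -> hypergraph V) (I : 'I_m -> {set V}) : Prop :=
  [/\ forall i j : 'I_m, i != j -> [disjoint I i & I j],
      \bigcup_(i < m) I i = [set: V]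
    & forall i : 'I_m, independent (H i) (I i)].

Definition hypergraph_class := forall V : finType, hypergraph V -> Prop.

Definition always_colorable (C : hypergraph_class) (m : nat) : Prop :=
  forall (V : finType) (H : 'I_m -> hypergraph V),
    (forall i : 'I_m, C V (H i)) ->
    exists I : 'I_m -> {set V}, cooperative_coloring H I.

(* chi_co(C) = m.  Candidates include 0, which never qualifies: zero parts
   cannot cover a nonempty V. *)
Definition is_cooperative_chromatic_number (C : hypergraph_class) (m : nat)
    : Prop :=
  always_colorable C m /\ forall m' : nat, always_colorable C m' -> m <= m'.

(* For s = v_0 ... v_(n-1), the set {v_i, ..., v_(i+k-1)} with indices mod n
   is [take k (rot i s)]; without wrap-around it is [take k (drop i s)]. *)
Definition tight_cycle (k : nat) : hypergraph_class := fun V E =>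
  uniform k E /\
  exists s : seq V,
    [/\ uniq s, forall x : V, x \in s, k <= size s
      & E = [set [set x in take k (rot i s)] | i : 'I_(size s)]].

Definition tight_path (k : nat) : hypergraph_class := fun V E =>
  uniform k E /\
  exists s : seq V,
    [/\ uniq s, forall x : V, x \in s, k <= size s
      & E = [set [set x in take k (drop i s)] | i : 'I_(size s - k).+1]].

(* [ordS] is the cyclic successor on 'I_m.  No lower bound on m beyond m > 0
   is needed: m = 1 contradicts uniformity (for k > 1), m = 2 the injectivity
   of v. *)
Definition loose_cycle (k : nat) : hypergraph_class := fun V E =>
  uniform k E /\
  exists (m : nat) (e : 'I_m -> {set V}) (v : 'I_m -> V),
    [/\ 0 < m,
        E = [set e i | i : 'I_m] /\ cover E = [set: V],
        forall i : 'I_m, e i :&: e (ordS i) = [set v i],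
        injective v
      & forall i j : 'I_m, i != j -> j != ordS i -> i != ordS j ->
          [disjoint e i & e j]].

(* The path has m.+1 edges; for i : 'I_m, [lift ord_max i] and [lift ord0 i]
   are the indices i and i.+1 in 'I_m.+1. *)
Definition loose_path (k : nat) : hypergraph_class := fun V E =>
  uniform k E /\
  exists (m : nat) (e : 'I_m.+1 -> {set V}) (v : 'I_m -> V),
    [/\ E = [set e i | i : 'I_m.+1],
        cover E = [set: V],
        forall i : 'I_m, e (lift ord_max i) :&: e (lift ord0 i) = [set v i],
        injective v
      & forall i j : 'I_m.+1, i.+1 < j -> [disjoint e i & e j]].

(* Main.v *)
Require Import Defs.
From mathcomp Require Import all_boot perm zify.

Set Implicit Arguments.
Unset Strict Implicit.
Unset Printing Implicit Defensive.

(** For two families of pairwise disjoint sets with at least two elements each,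
    some 2-coloring makes no set monochromatic: choosing a pair in each set
    yields two matchings, whose union is a bipartite graph.  It thus suffices to
    find in each hypergraph a family of disjoint blocks such that every edge
    contains a block.  In loose paths and cycles, each edge minus the vertex
    shared with the next one is a block.  In a tight cycle of even order (and in
    the tight paths it contains), pair up consecutive vertices.  In odd order
    leave the same vertex [a] unpaired in both cycles: only the edges centered at
    [a] may then contain no pair.  Giving [a] the second color settles one cycle,
    and, as [a] is in no pair, swapping the colors of all other vertices if needed
    gives the predecessor of [a] in the other cycle the first color. *)

(** * Common 2-colorings of two fixed-point-free involutions *)

Section Involutions.

Variables (T : finType) (f g : T -> T).
Hypotheses (fK : involutive f) (gK : involutive g).
Hypotheses (f_free : forall x, f x != x) (g_free : forall x, g x != x).

Let h := g \o f.

Let h_inj : injective h.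
Proof. exact: inj_comp (inv_inj gK) (inv_inj fK). Qed.

Let h_sym := fconnect_sym h_inj.

Let iter_h_inj n : injective (iter n h).
Proof. by elim: n => //= n IHn x y /h_inj /IHn. Qed.

(** Conjugation by [f] inverts [h], since [h (f (h x)) = f x]. *)
Let iter_h_f n x : iter n h (f (iter n h x)) = f x.
Proof. by elim: n => //= n IHn; rewrite -iterS iterSr /h /= fK gK IHn. Qed.

(* If [f x] is the [i]-th iterate of [h] at [x], then the midpoint [y] satisfies
   [y = f y] or [g (f y) = f y], depending on the parity of [i]. *)
Let f_disconnected x : ~~ fconnect h x (f x).
Proof.
apply/negP => /iter_findex; move: (findex _ _ _) => i.
rewrite -(odd_double_half i) -addnn addnC -addnA iterD -{1}(iter_h_f i./2 x).
move/iter_h_inj; rewrite addnC iterD; case: (odd i) => /= /eqP.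
  by rewrite /h /= (negPf (g_free _)).
by rewrite eq_sym (negPf (f_free _)).
Qed.

Lemma involutions_bicolorable :
  exists c : T -> bool, forall x, c (f x) = ~~ c x /\ c (g x) = ~~ c x.
Proof.
(* Both [f] and [g] send the [h]-cycle of [x] to one and the same other cycle. Of two cycles paired
   in this way, the one of smaller rank gets the color [true]. *)
pose rk x := enum_rank (froot h x).
have rk_g x : rk (g x) = rk (f x).
  have -> : g x = h (f x) by rewrite /h /= fK.
  by congr enum_rank; apply/eqP; rewrite root_connect // h_sym fconnect1.
have rk_fg x : rk (f (g x)) = rk x.
  by rewrite -[in RHS](gK x) rk_g.
have rk_f x : rk (f x) != rk x.
  rewrite (inj_eq enum_rank_inj) root_connect // h_sym; exact: f_disconnected.
exists (fun x => rk x < rk (f x)) => x; rewrite fK rk_g rk_fg -leqNgt.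
by rewrite [in LHS]ltn_neqAle rk_f.
Qed.

End Involutions.

(** * Bicolored sets and families of disjoint blocks *)

Definition bicolored (T : finType) (c : T -> bool) (B : {set T}) :=
  forall b, exists2 x, x \in B & c x = b.

Lemma bicoloredS (T : finType) (c : T -> bool) (A B : {set T}) :
  A \subset B -> bicolored c A -> bicolored c B.
Proof. by move=> /subsetP sAB cA b; have [x /sAB xB] := cA b; exists x. Qed.

Lemma bicolored2 (T : finType) (c : T -> bool) (x y : T) :
  c x != c y -> bicolored c [set x; y].
Proof.
move=> cxy b; have [|cxb] := eqVneq (c x) b; first by exists x; rewrite ?set21.
by exists y; rewrite ?set22 //; move: cxy cxb; case: (c x) (c y) b => [] [] [].
Qed.

Lemma bicolored2E (T : finType) (c : T -> bool) (x y : T) :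
  bicolored c [set x; y] -> c x != c y.
Proof.
move=> cxy; apply/eqP => eq_c.
by have [z /set2P[]-> /eqP] := cxy (~~ c x); rewrite -?eq_c; case: (c x).
Qed.

(** The involution swaps one chosen pair inside each block and fixes all other points; disjointness
    of the blocks makes it well defined. *)
Lemma matching_of_blocks (T : finType) (P : {set {set T}}) :
    trivIset P -> (forall B, B \in P -> 1 < #|B|) ->
  exists2 f : T -> T, involutive f &
    forall B, B \in P -> exists2 x, x \in B & (f x \in B) && (f x != x).
Proof.
move=> tiP P2.
(* [x0] only fills the default pair of sets outside [P]. If [T] is empty, no set has two elements
   and [P] is empty. *)
have [x0 _|T0] := pickP T; last first.
  by exists id => // B /P2/card_gt1P[x]; have := T0 x.
have pP B : exists u : T * T, B \in P -> [/\ u.1 \in B, u.2 \in B & u.1 != u.2].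
  have [/P2/card_gt1P[x [y [? ? ?]]]|_] := boolP (B \in P); last by exists (x0, x0).
  by exists (x, y).
have [u uP] := fin_all_exists pP.
pose f x := if x \in cover P then tperm (u (pblock P x)).1 (u (pblock P x)).2 x
            else x.
have fE B x : B \in P -> x \in B -> f x = tperm (u B).1 (u B).2 x.
  move=> PB Bx; rewrite /f (def_pblock tiP PB Bx) ifT //.
  by apply/bigcupP; exists B.
have fB B x : B \in P -> x \in B -> f x \in B.
  by move=> PB Bx; have [? ? _] := uP B PB; rewrite (fE B) //; case: tpermP.
exists f => [x|B PB].
  have [/bigcupP[B PB Bx]|ncx] := boolP (x \in cover P).
    by rewrite [f (f x)](fE B) ?fB // (fE B) // tpermK.
  by rewrite /f (negPf ncx) (negPf ncx).
have [u1 u2 ne_u] := uP B PB; exists (u B).1 => //.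
by rewrite (fE B) // tpermL u2 eq_sym.
Qed.

Lemma blocks_bicolorable (T : finType) (P Q : {set {set T}}) :
    trivIset P -> trivIset Q -> (forall B, B \in P :|: Q -> 1 < #|B|) ->
  exists c : T -> bool, forall B, B \in P :|: Q -> bicolored c B.
Proof.
move=> tiP tiQ PQ2.
have [B PB|f fK fP] := matching_of_blocks tiP.
  by apply: PQ2; rewrite inE PB.
have [B QB|g gK gP] := matching_of_blocks tiQ.
  by apply: PQ2; rewrite inE QB orbT.
(* Doubling [T] and joining the two copies of each fixed point turns involutions
   of [T] into fixed-point-free ones. *)
pose dbl (k : T -> T) (u : T * bool) :=
  if k u.1 == u.1 then (u.1, ~~ u.2) else (k u.1, u.2).
have dblK k : involutive k -> involutive (dbl k).
  move=> kK [x b]; rewrite /dbl /=; case: (eqVneq (k x) x) => /= [->|ne].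
    by rewrite eqxx negbK.
  by rewrite kK eq_sym (negPf ne).
have dbl_free k u : dbl k u != u.
  case: u => x b; rewrite /dbl /=; case: (eqVneq (k x) x) => [_|ne].
    by rewrite xpair_eqE eqxx; case: b.
  by rewrite xpair_eqE (negPf ne).
have [c cP] := involutions_bicolorable
  (dblK f fK) (dblK g gK) (dbl_free f) (dbl_free g).
(* [dbl] keeps a moved point in its layer, so the layer [false] alone already alternates on the
   chosen pairs. *)
have bic (B : {set T}) k x : (forall u, c (dbl k u) = ~~ c u) -> x \in B ->
    (k x \in B) && (k x != x) -> bicolored (fun y => c (y, false)) B.
  move=> ck Bx /andP[Bkx ne]; apply: (@bicoloredS _ _ [set x; k x]).
    by rewrite subUset !sub1set Bx.
  apply: bicolored2; have := ck (x, false); rewrite /dbl /= (negPf ne) => ->.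
  by case: (c _).
exists (fun y => c (y, false)) => B /setUP[/fP|/gP] [x Bx Bkx].
  by apply: bic Bx Bkx => u; have [] := cP u.
by apply: bic Bx Bkx => u; have [] := cP u.
Qed.

(** * Cooperative colorings with two parts, and the lower bound *)

Lemma ord2P (i : 'I_2) : i = ord0 \/ i = ord_max.
Proof. by case: i => [[|[|//]] lti]; [left|right]; apply: val_inj. Qed.

(** The color class [true] serves as the part of [ord0], the class [false] as that of [ord_max]. *)
Lemma cooperative_coloring2 (V : finType) (H : 'I_2 -> hypergraph V) (c : V -> bool) :
    (forall e, e \in H ord0 -> exists2 x, x \in e & c x = false) ->
    (forall e, e \in H ord_max -> exists2 x, x \in e & c x = true) ->
  exists I, cooperative_coloring H I.
Proof.
move=> H0 H1; exists (fun i => [set x | c x == (i == ord0)]); split.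
- move=> i j ne_ij; rewrite -setI_eq0; apply/eqP/setP => x; rewrite !inE.
  case: eqP => //= ->; apply: contraNF ne_ij.
  by case: (ord2P i) => ->; case: (ord2P j) => ->.
- apply/setP => x; rewrite inE; apply/bigcupP.
  by exists (if c x then ord0 else ord_max); rewrite // inE; case: (c x).
- move=> i e; case: (ord2P i) => -> => [/H0|/H1] [x ex cx].
    by apply/subsetPn; exists x; rewrite // inE cx.
  by apply/subsetPn; exists x; rewrite // inE cx.
Qed.

(** Zero parts leave [x] uncovered; a single part is all of [V] and contains [e]. *)
Lemma chromatic_number_gt1 (C : hypergraph_class) (V : finType) (E : hypergraph V)
    (e : {set V}) (x : V) :
  C V E -> e \in E -> forall m, always_colorable C m -> 1 < m.
Proof.
move=> CE Ee [|[|m]] // /(_ V (fun _ => E)) [//|I [_ cvI indI]].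
  by have := in_setT x; rewrite -cvI big_ord0 inE.
by have /negP[] := indI ord0 e Ee; move: cvI; rewrite big_ord1 => ->; apply: subsetT.
Qed.

(** * Block systems, for loose cycles and loose paths *)

Definition block_system (V : finType) (E : hypergraph V) (P : {set {set V}}) :=
  [/\ trivIset P, forall B, B \in P -> 1 < #|B|
    & forall e, e \in E -> exists2 B, B \in P & B \subset e].

Lemma block_systems_colorable (V : finType) (H : 'I_2 -> hypergraph V) :
  (forall i, exists P, block_system (H i) P) -> exists I, cooperative_coloring H I.
Proof.
move=> HP; have [P [tiP P2 PE]] := HP ord0; have [Q [tiQ Q2 QE]] := HP ord_max.
have [|c cP] := blocks_bicolorable tiP tiQ.
  by move=> B /setUP[/P2|/Q2].
apply: (@cooperative_coloring2 _ _ c) => e.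
  by case/PE => B PB sBe; apply: (bicoloredS sBe); apply: cP; rewrite inE PB.
by case/QE => B QB sBe; apply: (bicoloredS sBe); apply: cP; rewrite inE QB orbT.
Qed.

Lemma loose_cycle_block_system (k : nat) (V : finType) (E : hypergraph V) :
  3 <= k -> loose_cycle k E -> exists P, block_system E P.
Proof.
move=> hk [unif [m [e [v [m_gt0 [defE _] ev _ disj]]]]].
(* Blocks of consecutive edges lose the only common vertex, and each keeps [k - 1 >= 2] vertices. *)
exists [set e i :\ v i | i : 'I_m]; split.
- apply/trivIsetP => _ _ /imsetP[i _ ->] /imsetP[j _ ->] ne_ij.
  have {ne_ij} ne_ij : i != j by apply: contraNneq ne_ij => ->.
  rewrite -setI_eq0; apply/eqP/setP => x; rewrite !inE.
  apply/negP => /andP[/andP[xvi xi] /andP[xvj xj]].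
  have [eij|nij] := eqVneq j (ordS i).
    by case/negP: xvi; rewrite -in_set1 -ev inE xi -eij.
  have [eji|nji] := eqVneq i (ordS j).
    by case/negP: xvj; rewrite -in_set1 -ev inE xj -eji.
  by have /disjointFr/(_ xi) := disj i j ne_ij nij nji; rewrite xj.
- move=> _ /imsetP[i _ ->]; have := cardsD1 (v i) (e i).
  rewrite unif ?defE ?imset_f //; lia.
- rewrite defE => _ /imsetP[i _ ->]; exists (e i :\ v i); last exact: subD1set.
  exact: imset_f.
Qed.

Lemma loose_path_block_system (k : nat) (V : finType) (E : hypergraph V) :
  3 <= k -> loose_path k E -> exists P, block_system E P.
Proof.
move=> hk [unif [m [e [v [defE _ ev _ disj]]]]].
(* The last edge has no successor and stays whole. *)
pose b i := if unlift ord_max i is Some j then e i :\ v j else e i.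
have sbe i : b i \subset e i.
  by rewrite /b; case: unliftP => [j|] _; rewrite ?subD1set.
have disj_b (i j : 'I_m.+1) : i < j -> [disjoint b i & b j].
  rewrite leq_eqVlt => /predU1P[|/disj]; last first.
    by move/(disjointWl (sbe i))/(disjointWr (sbe j)).
  rewrite {1}/b; case: unliftP => [i' ->|->] ij; last first.
    by move: ij (ltn_ord j) => /= <-; rewrite ltnn.
  have ej : j = lift ord0 i'.
    by apply: val_inj; rewrite /= -ij /= /bump [m <= _]leqNgt ltn_ord.
  rewrite -setI_eq0; apply/eqP/setP => x; rewrite !inE.
  apply/negP => /andP[/andP[xv xi] /(subsetP (sbe j)) xj].
  by case/negP: xv; rewrite -in_set1 -ev inE xi -ej.
exists [set b i | i : 'I_m.+1]; split.
- apply/trivIsetP => _ _ /imsetP[i _ ->] /imsetP[j _ ->] ne_ij.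
  have [/disj_b//|/disj_b|/val_inj eq_ij] := ltngtP i j.
    by rewrite disjoint_sym.
  by rewrite eq_ij eqxx in ne_ij.
- move=> _ /imsetP[i _ ->]; have ck : #|e i| = k by rewrite unif ?defE ?imset_f.
  rewrite /b; case: unliftP => [j|] _; last by rewrite ck; lia.
  by have := cardsD1 (v j) (e i); rewrite ck; lia.
- by rewrite defE => _ /imsetP[i _ ->]; exists (b i); rewrite ?imset_f.
Qed.

(** * Tight cycles and tight paths *)

Definition cyclic_windows (V : finType) (k : nat) (s : seq V) : hypergraph V :=
  [set [set x in take k (rot i s)] | i : 'I_(size s)].

(** The first three vertices of a window are all that the coloring argument uses, whatever the value
    of [k]. *)
Lemma cyclic_window_next (V : finType) (k : nat) (s : seq V) (e : {set V}) :
    uniq s -> 2 < k -> 2 < size s -> e \in cyclic_windows k s ->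
  exists2 x, x \in s & [/\ x \in e, next s x \in e & next s (next s x) \in e].
Proof.
move=> Us hk hs /imsetP[i _ ->].
have Ur : uniq (rot i s) by rewrite rot_uniq.
have hr : 2 < size (rot i s) by rewrite size_rot.
have nr : next s =1 next (rot i s) by move=> x; rewrite next_rot.
have mr := mem_rot i s.
case: (rot i s) Ur hr nr mr => [|x [|y [|z r]]] //= Ur _ nr mr.
case: k hk => [|[|[|k]]] // _; exists x; first by rewrite -mr mem_head.
have nx : next s x = y by rewrite nr /= eqxx.
have ny : next s y = z.
  rewrite nr /= eqxx; case: eqP => // yx; move: Ur; by rewrite yx !inE eqxx.
by rewrite nx ny !inE !eqxx !orbT.
Qed.

Lemma ltn_half_double (n i : nat) : i < n./2 -> (i.*2 < n) * (i.*2.+1 < n).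
Proof. by move=> lti; split; lia. Qed.

(** The head only provides a default for [nth]. In odd size the last vertex stays unpaired. *)
Definition consecutive_pairs (V : finType) (s : seq V) : {set {set V}} :=
  if s is x0 :: _ then
    [set [set nth x0 s i.*2; nth x0 s i.*2.+1] | i : 'I_(size s)./2]
  else set0.

Lemma consecutive_pairs_trivIset (V : finType) (s : seq V) :
  uniq s -> trivIset (consecutive_pairs s).
Proof.
case: s => [|x0 s'] Us; first by apply/trivIsetP => B ?; rewrite inE.
rewrite /consecutive_pairs; move: (x0 :: s') Us => {s'} s Us.
apply/trivIsetP => _ _ /imsetP[i _ ->] /imsetP[j _ ->] ne_ij.
have {}ne_ij : (i : nat) <> j by move=> eq_ij; rewrite eq_ij eqxx in ne_ij.
move: (i : nat) (j : nat) (ltn_ord i) (ltn_ord j) ne_ij => {}i {}j lti ltj ne_ij.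
rewrite -setI_eq0; apply/eqP/setP => x; rewrite !inE.
apply/negP => /andP[/orP[]/eqP-> /orP[]]; rewrite nth_uniq ?ltn_half_double //; lia.
Qed.

Lemma consecutive_pairs_gt1 (V : finType) (s : seq V) (B : {set V}) :
  uniq s -> B \in consecutive_pairs s -> 1 < #|B|.
Proof.
case: s => [|x0 s'] Us; rewrite /consecutive_pairs ?inE //.
move: (x0 :: s') Us => {s'} s Us.
case/imsetP => i _ ->; move: (i : nat) (ltn_ord i) => {}i lti.
rewrite cards2 nth_uniq ?ltn_half_double //; lia.
Qed.

Lemma mem_consecutive_pairs (V : finType) (s : seq V) (x0 : V) (i : nat) :
    ~~ odd i -> i.+1 < size s ->
  [set nth x0 s i; nth x0 s i.+1] \in consecutive_pairs s.
Proof.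
case: s => [|y0 s'] // ev_i lti; apply/imsetP.
have lt2 : i./2 < (size (y0 :: s'))./2 by lia.
exists (Ordinal lt2) => //=; rewrite (even_halfK ev_i).
by rewrite !(set_nth_default y0 x0) // ltnW.
Qed.

(** Among three consecutive vertices, the first two or the last two form a pair, unless the middle
    one is the unpaired [a]; [last_col] handles that case. *)
Lemma cyclic_windows_hit (V : finType) (k j : nat) (s0 s : seq V) (a : V)
    (c : V -> bool) (b : bool) :
    rot j s0 = a :: s -> uniq s0 -> 2 < k -> 1 < size s ->
    (forall B, B \in consecutive_pairs (drop (odd (size (a :: s))) (a :: s)) ->
      bicolored c B) ->
    (~~ odd (size s) -> c a = b \/ c (last a s) = b) ->
  forall e, e \in cyclic_windows k s0 -> exists2 x, x \in e & c x = b.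
Proof.
move=> rot_s0 Us0 hk hs pairs last_col e eP; set t := a :: s in rot_s0 pairs.
have Us : uniq t by rewrite -rot_s0 rot_uniq.
have next_s0 : next s0 =1 next t by move=> y; rewrite -rot_s0 next_rot.
have [|x] := cyclic_window_next Us0 hk _ eP; first by rewrite -(size_rot j) rot_s0.
rewrite -(mem_rot j) rot_s0 !next_s0 => tx [ex enx ennx].
(* The default [a] makes this hold at the last position too, where [next] wraps around to the
   head. *)
have next_t l : l < size t -> next t (nth a t l) = nth a t l.+1.
  by move=> ltl; rewrite next_nth mem_nth // index_uniq.
have pairP l : odd l = odd (size t) -> l.+1 < size t ->
    nth a t l \in e -> nth a t l.+1 \in e -> exists2 y, y \in e & c y = b.
  move=> odd_l ltl el el1.
  have : [set nth a t l; nth a t l.+1] \in consecutive_pairs (drop (odd (size t)) t).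
    case: (odd (size t)) odd_l => odd_l.
      case: l odd_l ltl {el el1} => // l odd_l ltl.
      by rewrite drop1; apply: (@mem_consecutive_pairs _ s).
    by rewrite drop0 mem_consecutive_pairs ?odd_l.
  by case/pairs/(_ b) => y /set2P[]-> cy; [exists (nth a t l)|exists (nth a t l.+1)].
set i := index x t; have lti : i < size t by rewrite index_mem.
have xE : nth a t i = x by rewrite nth_index.
have nxE : nth a t i.+1 = next t x by rewrite -next_t // xE.
have [odd_i|odd_i] := eqVneq (odd i) (odd (size t)).
  by apply: (pairP i); rewrite ?xE ?nxE //; move: odd_i lti; lia.
(* The parity of [i] excludes [i.+2 = size t], so the second and third vertices form a pair. *)
have [lti1|] := ltnP i.+1 (size t).
  have nnxE : nth a t i.+2 = next t (next t x) by rewrite -nxE next_t.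
  apply: (pairP i.+1); rewrite ?nxE ?nnxE //.
    by move: odd_i; rewrite [odd i.+1]/=; case: (odd i) (odd (size t)) => [] [].
  rewrite ltn_neqAle lti1 andbT; apply: contraNneq odd_i => <-.
  by rewrite [odd i.+2]/= negbK.
(* Now [x] is the last vertex and [a] follows it. In even order [a] starts a pair; in odd order it
   is unpaired. *)
move=> gei1; have eq_i : i = size s by move: lti gei1; rewrite /=; lia.
have nxa : next t x = a by rewrite -nxE nth_default.
have [odd_s|/last_col[ca|cl]] := boolP (odd (size s)).
- apply: (pairP 0); first by rewrite /= odd_s.
  + by rewrite ltnW.
  + by rewrite -[nth a t 0]nxa.
  by rewrite -next_t // -[nth a t 0]nxa.
- by exists a; rewrite // -nxa.
by exists x; rewrite // -xE eq_i nth_last.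
Qed.

Lemma consecutive_pairs_mem (V : finType) (s : seq V) (B : {set V}) (x : V) :
  B \in consecutive_pairs s -> x \in B -> x \in s.
Proof.
case: s => [|x0 s']; first by rewrite inE.
case/imsetP => i _ ->.
by case/set2P=> ->; rewrite mem_nth ?ltn_half_double.
Qed.

Lemma tight_cycles_bicolorable (V : finType) (k : nat) (s1 s2 : seq V) :
    2 < k -> 2 < size s1 -> uniq s1 -> uniq s2 -> s1 =i s2 ->
  exists c : V -> bool,
    (forall e, e \in cyclic_windows k s1 -> exists2 x, x \in e & c x = false) /\
    (forall e, e \in cyclic_windows k s2 -> exists2 x, x \in e & c x = true).
Proof.
move=> hk hs1 U1 U2 eq12.
have sz12 : size s2 = size s1.
  by apply/eqP; rewrite eq_sym -uniq_size_uniq // => x; rewrite eq12.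
have [a s1a] : exists a, a \in s1 by case: (s1) hs1 => // a s _; exists a; apply: mem_head.
have s2a : a \in s2 by rewrite -eq12.
have [i1 t1 rot1] := rot_to s1a; have [i2 t2 rot2] := rot_to s2a.
have sz1 : size s1 = (size t1).+1 by rewrite -(size_rot i1) rot1.
have sz2 : size t2 = size t1.
  by apply: succn_inj; rewrite -sz1 -sz12 -(size_rot i2 s2) rot2.
have Ut1 : uniq (a :: t1) by rewrite -rot1 rot_uniq.
have Ut2 : uniq (a :: t2) by rewrite -rot2 rot_uniq.
have ht1 : 1 < size t1 by rewrite -ltnS -sz1.
have ht2 : 1 < size t2 by rewrite sz2.
pose P t := consecutive_pairs (drop (odd (size (a :: t))) (a :: t)).
have tiP t : uniq (a :: t) -> trivIset (P t).
  by move=> Ut; rewrite consecutive_pairs_trivIset // drop_uniq.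
have [|c0 c0P] := blocks_bicolorable (tiP _ Ut1) (tiP _ Ut2).
  by move=> B /setUP[] /consecutive_pairs_gt1 -> //; rewrite drop_uniq.
have c0P1 B : B \in P t1 -> bicolored c0 B by move=> PB; apply: c0P; rewrite inE PB.
have c0P2 B : B \in P t2 -> bicolored c0 B.
  by move=> PB; apply: c0P; rewrite inE PB orbT.
(* With an even number of vertices, the pairs cover both cycles and the condition on [a] is
   vacuous. *)
have [odd_t|even_t] := boolP (odd (size t1)).
  exists c0; split; [apply: cyclic_windows_hit rot1 _ _ _ _ _|
                     apply: cyclic_windows_hit rot2 _ _ _ _ _] => //.
    by rewrite odd_t.
  by rewrite sz2 odd_t.
(* [a] gets [true] for the second cycle; the xor gives its predecessor in the first cycle the color
   [false]. *)
pose c y := (y == a) || (c0 y (+) c0 (last a t1)).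
have cP t : uniq (a :: t) -> ~~ odd (size t) ->
    (forall B, B \in P t -> bicolored c0 B) -> forall B, B \in P t -> bicolored c B.
  move=> /= /andP[nta _] odd_t bic B PB b.
  have [x Bx cx] := bic B PB (b (+) c0 (last a t1)); exists x => //.
  (* Recoloring [a] is harmless: it is dropped before the pairing, so it lies in no block. *)
  rewrite /c cx addbK; case: eqP => //= xa.
  move: nta PB; rewrite /P /= odd_t drop1 -xa /= => ntx /consecutive_pairs_mem/(_ Bx).
  by rewrite (negPf ntx).
exists c; split; [apply: cyclic_windows_hit rot1 _ _ _ _ _|
                  apply: cyclic_windows_hit rot2 _ _ _ _ _] => //.
- exact: cP.
- move=> _; right; rewrite /c addbb orbF.
  case: (t1) Ut1 ht1 => //= y t /andP[nta _] _.
  by apply: contraNF nta => /eqP <-; apply: mem_last.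
- by apply: cP; rewrite ?sz2.
- by left; rewrite /c eqxx.
Qed.

Lemma tight_cycle_always_colorable (k : nat) :
  2 < k -> always_colorable (tight_cycle k) 2.
Proof.
move=> hk V H CH; have [_ [s1 [U1 V1 hs1 E1]]] := CH ord0.
have [_ [s2 [U2 V2 _ E2]]] := CH ord_max.
have eq12 : s1 =i s2 by move=> x; rewrite V1 V2.
have [c [c1 c2]] := tight_cycles_bicolorable hk (leq_trans hk hs1) U1 U2 eq12.
by apply: (@cooperative_coloring2 _ _ c); rewrite ?E1 ?E2.
Qed.

Lemma tight_path_always_colorable (k : nat) :
  2 < k -> always_colorable (tight_path k) 2.
Proof.
move=> hk V H CH; have [_ [s1 [U1 V1 hs1 E1]]] := CH ord0.
have [_ [s2 [U2 V2 hs2 E2]]] := CH ord_max.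
have eq12 : s1 =i s2 by move=> x; rewrite V1 V2.
have [c [c1 c2]] := tight_cycles_bicolorable hk (leq_trans hk hs1) U1 U2 eq12.
(* Windows of a path do not wrap around, hence are cyclic windows of the same sequence. *)
have windows (s : seq V) (i : 'I_(size s - k).+1) : k <= size s ->
    [set x in take k (drop i s)] \in cyclic_windows k s.
  move=> hs; have lti := ltn_ord i.
  have lt_is : i < size s by lia.
  apply/imsetP; exists (Ordinal lt_is) => //=.
  by rewrite /rot takel_cat // size_drop; lia.
apply: (@cooperative_coloring2 _ _ c) => e.
  by rewrite E1 => /imsetP[i _ ->]; apply/c1/windows.
by rewrite E2 => /imsetP[i _ ->]; apply/c2/windows.
Qed.

(** * Members of each class, for the lower bounds *)

Lemma single_edge_uniform (k : nat) : uniform k [set [set: 'I_k]].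
Proof. by move=> _ /set1P->; rewrite cardsT card_ord. Qed.

(** On exactly [k] vertices, all windows coincide with the vertex set. *)
Lemma single_edge_tight_cycle (k : nat) : 0 < k -> tight_cycle k [set [set: 'I_k]].
Proof.
move=> hk; split; first exact: single_edge_uniform.
exists (enum 'I_k); split; rewrite ?enum_uniq ?size_enum_ord //.
  by move=> x; rewrite mem_enum.
apply/setP => e; rewrite inE; apply/eqP/imsetP => [->|[i _ ->]].
  exists (Ordinal hk) => //; apply/setP => x; rewrite !inE take_oversize.
    by rewrite mem_rot mem_enum.
  by rewrite size_rot size_enum_ord.
apply/setP => x; rewrite !inE take_oversize ?mem_rot ?mem_enum //.
by rewrite size_rot size_enum_ord.
Qed.

Lemma single_edge_tight_path (k : nat) : tight_path k [set [set: 'I_k]].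
Proof.
split; first exact: single_edge_uniform.
exists (enum 'I_k); split; rewrite ?enum_uniq ?size_enum_ord //.
  by move=> x; rewrite mem_enum.
have full i : i < (k - k).+1 -> [set x in take k (drop i (enum 'I_k))] = [set: 'I_k].
  rewrite subnn; case: i => // _; apply/setP => x.
  by rewrite drop0 take_oversize ?size_enum_ord // !inE mem_enum.
apply/setP => e; rewrite inE; apply/eqP/imsetP => [->|[i _ ->]].
  by exists ord0; rewrite // full.
by rewrite full.
Qed.

Lemma single_edge_loose_path (k : nat) : loose_path k [set [set: 'I_k]].
Proof.
split; first exact: single_edge_uniform.
have v : 'I_0 -> 'I_k by case.
exists 0, (fun _ => setT), v; split; try by case.
- apply/setP => e; rewrite inE; apply/eqP/imsetP => [->|[i _ ->]] //.
  by exists ord0.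
- by rewrite /cover big_set1.
by move=> i j; rewrite (ord1 i) (ord1 j).
Qed.

(* Loose cycles have at least three edges; this is the loose triangle, whose
   [i]-th edge consists of the [i]-th row and the first vertex of the next one. *)
Definition loose_triangle_edge (k : nat) (i : 'I_3) : {set 'I_3 * 'I_k.+2} :=
  (ordS i, ord0) |: [set u | u.1 == i].

Lemma ord3P (P : 'I_3 -> Prop) :
  P ord0 -> P (ordS ord0) -> P (ordS (ordS ord0)) -> forall i, P i.
Proof.
move=> P0 P1 P2 [[|[|[|//]]] lti].
- by rewrite (_ : Ordinal lti = ord0) //; apply: val_inj.
- by rewrite (_ : Ordinal lti = ordS ord0) //; apply: val_inj.
by rewrite (_ : Ordinal lti = ordS (ordS ord0)) //; apply: val_inj.
Qed.

Lemma loose_triangle (k : nat) :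
  loose_cycle k.+3 [set loose_triangle_edge k i | i : 'I_3].
Proof.
split=> [_ /imsetP[i _ ->]|].
  rewrite cardsU1 (_ : [set u | u.1 == i] = setX [set i] [set: 'I_k.+2]); last first.
    by apply/setP => u; rewrite !inE andbT.
  by rewrite cardsX cards1 cardsT card_ord mul1n !inE; elim/ord3P: i.
exists 3, (loose_triangle_edge k), (fun i => (ordS i, ord0)); split => //.
- split=> //; apply/setP => u; rewrite inE; apply/bigcupP.
  exists (loose_triangle_edge k u.1); first exact: imset_f.
  by rewrite !inE eqxx orbT.
- move=> i; apply/setP => -[j l]; rewrite !inE !xpair_eqE /=.
  by elim/ord3P: i; elim/ord3P: j => /=; case: (l == ord0).
- by move=> i j [/eqP]; elim/ord3P: i; elim/ord3P: j.
(* Any two of the three edges are consecutive, so the disjointness condition is vacuous. *)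
by move=> i j; elim/ord3P: i; elim/ord3P: j.
Qed.

Theorem corollary2p2 (k : nat) (hk : 3 <= k) :
  [/\ is_cooperative_chromatic_number (tight_cycle k) 2,
      is_cooperative_chromatic_number (loose_cycle k) 2,
      is_cooperative_chromatic_number (tight_path k) 2
    & is_cooperative_chromatic_number (loose_path k) 2].
Proof.
case: k hk => [|[|[|k]]] // hk; split; split.
- exact: tight_cycle_always_colorable.
- apply: (chromatic_number_gt1 (e := setT) ord0); last exact: set11.
  exact: single_edge_tight_cycle.
- move=> V H CH; apply: block_systems_colorable => i.
  exact: loose_cycle_block_system (CH i).
- apply: (chromatic_number_gt1 (ord0, ord0) (loose_triangle k)).
  exact: (imset_f _ (x := ord0)).
- exact: tight_path_always_colorable.
- apply: (chromatic_number_gt1 (e := setT) ord0); last exact: set11.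
  exact: single_edge_tight_path.
- move=> V H CH; apply: block_systems_colorable => i.
  exact: loose_path_block_system (CH i).
- apply: (chromatic_number_gt1 (e := setT) ord0); last exact: set11.
  exact: single_edge_loose_path.
Qed.
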